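(* Let $A$ be an (arbitrary) algebra over a field $K$ of characteristic zero and let $s\ge1$. The following statements are equivalent. 1. The algebra $A$ admits a finite set of commuting locally nilpotent derivations $\delta_1,\ldots,\delta_s\in\mathrm{Der}_K(A)$ with left localizable kernels. 2. There exists a left Ore set $S$ of the algebra $A$ such that $S\subseteq A^{reg}$, $S^{-1}A=B[x_1;d_1]\cdots[x_s;d_s]$ is an iterated Ore extension such that $S\subseteq B$, $d_i(B)\subseteq B$ and $d_i(x_j)\in B$ for all $1\le i,j\le s$, and the algebra $A$ is $\partial_i$-invariant ($\partial_i(A)\subseteq A$) for all $1\le i\le s$, where $\partial_i:=\frac{\partial}{\partial x_i}\in\mathrm{Der}_B(S^{-1}A)$ are the formal partial derivatives of the $B$-algebra $S^{-1}A$. If the first condition holds then there exists a left Ore set $S\subseteq A^\delta\cap A^{reg}$ such that $S^{-1}A=(S^{-1}A)^\delta[x_1;d_1]\cdots[x_s;d_s]$ is an iterated Ore extension such that $d_i((S^{-1}A)^\delta)\subseteq(S^{-1}A)^\delta$ and $d_i(x_j)\in(S^{-1}A)^\delta$ for all $1\le i,j\le s$. In particular, $S^{-1}A=\bigoplus_{\alpha\in\mathbb N^s}(S^{-1}A)^\delta x^\alpha=\bigoplus_{\alpha\in\mathbb N^s}x^\alpha(S^{-1}A)^\delta$ and $S^{-1}A=\bigcup_{i\ge0}N_i'$, $N_i'=\bigoplus_{|\alpha|\le i}(S^{-1}A)^\delta x^\alpha=\bigoplus_{|\alpha|\le i}x^\alpha(S^{-1}A)^\delta$, $i\ge0$. Finally,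 $A=\bigcup_{i\ge0}N_i$ and $N_i'=S^{-1}N_i$ for all $i\ge0$; in particular, $S^{-1}(A^\delta)=(S^{-1}A)^\delta$ and $A^\delta=A\cap(S^{-1}A)^\delta$.
   Context: Algebras are associative and unital, not necessarily commutative; $\mathbb N=\{0,1,\ldots\}$. A derivation is locally nilpotent if each element is killed by some power of it. For derivations $\delta_1,\ldots,\delta_s$ of $A$: $A^{\delta_i}=\ker\delta_i$, $A^\delta=\bigcap_{i=1}^sA^{\delta_i}$, $A^\delta_{\widehat i}=\bigcap_{j\ne i}A^{\delta_j}$ (equal to $A$ if $s=1$). $A^{reg}$ is the set of regular elements of $A$ (those that are neither left nor right zero divisors). The derivations have left localizable kernels if there is a left Ore set $S$ of $A$ with $S\subseteq A^\delta\cap A^{reg}$ and $S\cap\delta_i(A^\delta_{\widehat i})\ne\emptyset$ for all $i=1,\ldots,s$. For a left Ore set $S\subseteq A^{reg}$, $A$ is identified with its image in the left localization $S^{-1}A$; derivations of $A$ extend uniquely to $S^{-1}A$, are denoted by the same symbols, and $(S^{-1}A)^\delta$ is the common kernel of the extended $\delta_i$. For a ring $R$ with derivation $d$, the Ore extension $R[x;d]$ is the ring freely generated over $R$ by $x$ subject to $xr=rx+d(r)$. In an iterated Ore extension $B[x_1;d_1]\cdots[x_s;d_s]$, $d_i$ is the restriction of $\mathrm{ad}(x_i)=[x_i,\cdot]$ and $d_i(x_j)$ means $[x_i,x_j]=x_ix_j-x_jx_i$ for all $i,j$; $\frac{\partial}{\partial x_i}$ is the derivation killing $B$ with $\frac{\partial}{\partial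 x_i}(x_j)=\delta_{ij}$ (Kronecker delta). $x^\alpha=x_1^{\alpha_1}\cdots x_s^{\alpha_s}$, $\delta^\alpha=\delta_1^{\alpha_1}\cdots\delta_s^{\alpha_s}$, $|\alpha|=\alpha_1+\cdots+\alpha_s$. $N_i=\{a\in A\mid\delta^\alpha(a)=0\ \forall\,|\alpha|>i\}$, and $N_i'$ is the filtration of $S^{-1}A$ defined in the same way by the extended derivations. *)

(* Defs.v *)
From HB Require Import structures.
From mathcomp Require Export all_boot all_order all_algebra.
From mathcomp Require Export boolp classical_sets.

Set Implicit Arguments.
Unset Strict Implicit.
Unset Printing Implicit Defensive.

Import GRing.Theory.
Local Open Scope classical_set_scope.
Local Open Scope ring_scope.

Definition regular_elements (A : pzRingType) : set A :=
  [set a | GRing.lreg a /\ GRing.rreg a].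
Arguments regular_elements : clear implicits.

Definition left_ore_set (A : pzRingType) (S : set A) : Prop :=
  [/\ S 1,
      forall s t, S s -> S t -> S (s * t)
    & forall a s, S s -> exists a' s', S s' /\ s' * a = a' * s].

Definition inverse_of (Q : pzRingType) (q u : Q) : Prop :=
  u * q = 1 /\ q * u = 1.

(* [fractions j S M] is S^{-1}M, the set of the j(s)^{-1} j(m) in Q. *)
Definition fractions (A Q : pzRingType) (j : A -> Q) (S M : set A) : set Q :=
  [set q | exists s m u, [/\ S s, M m, inverse_of (j s) u & q = u * j m]].

(* [j : A -> Q] is the left localization of A at S.  The last field says that
   the kernel of j is the S-torsion, so j is injective when S is regular. *)
Definition left_localization (A Q : pzRingType) (S : set A) (j : A -> Q)
    : Prop :=
  [/\ forall s, S s -> exists u, inverse_of (j s) u,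
      fractions j S setT = setT
    & forall a, j a = 0 <-> exists2 s, S s & s * a = 0].

Definition subring (Q : pzRingType) (R : set Q) : Prop :=
  [/\ R 1, forall a b, R a -> R b -> R (a - b)
    & forall a b, R a -> R b -> R (a * b)].

Definition subalgebra (K : fieldType) (Q : algType K) (B : set Q) : Prop :=
  subring B /\ forall (k : K) b, B b -> B (k *: b).

Definition ring_morphism_on (Q T : pzRingType) (R : set Q) (f : Q -> T)
    : Prop :=
  [/\ f 1 = 1, forall a b, R a -> R b -> f (a + b) = f a + f b
    & forall a b, R a -> R b -> f (a * b) = f a * f b].

Definition leibniz_on (Q : pzRingType) (R : set Q) (d : Q -> Q) : Prop :=
  forall a b, R a -> R b -> d (a * b) = d a * b + a * d b.

Definition ring_derivation_on (Q : pzRingType) (R : set Q) (d : Q -> Q)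
    : Prop :=
  [/\ forall a, R a -> R (d a),
      forall a b, R a -> R b -> d (a + b) = d a + d b
    & leibniz_on R d].

Definition derivation (K : fieldType) (A : algType K) (d : A -> A) : Prop :=
  linear d /\ leibniz_on setT d.

Definition locally_nilpotent (A : pzRingType) (d : A -> A) : Prop :=
  forall a, exists n, iter n d a = 0.

Definition ad (Q : pzRingType) (x y : Q) : Q := x * y - y * x.

Section Families.
Variable (s : nat).

Definition common_kernel (A : pzRingType) (delta : 'I_s -> A -> A) : set A :=
  [set a | forall i, delta i a = 0].

Definition common_kernel_but (A : pzRingType) (delta : 'I_s -> A -> A)
    (i : 'I_s) : set A :=
  [set a | forall k, k != i -> delta k a = 0].

Definition left_localizable_kernels (A : pzRingType)
    (delta : 'I_s -> A -> A) : Prop :=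
  exists S : set A,
    [/\ left_ore_set S,
        S `<=` common_kernel delta `&` regular_elements A
      & forall i, (S `&` (delta i @` common_kernel_but delta i)) !=set0].

Definition commuting_LNDs_with_left_localizable_kernels
    (K : fieldType) (A : algType K) (delta : 'I_s -> A -> A) : Prop :=
  [/\ forall i, derivation (delta i),
      forall i, locally_nilpotent (delta i),
      forall i k a, delta i (delta k a) = delta k (delta i a)
    & left_localizable_kernels delta].

Definition multi_index := {ffun 'I_s -> nat}.

Definition mi_deg (alpha : multi_index) : nat := (\sum_(i < s) alpha i)%N.

(* x_1^alpha_1 ... x_s^alpha_s, the factors being taken in this order *)
Definition monomial (Q : pzRingType) (x : 'I_s -> Q) (alpha : multi_index)
    : Q :=
  \prod_(i < s) x i ^+ alpha i.

(* delta_1^alpha_1 o ... o delta_s^alpha_s *)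
Definition delta_pow (A : pzRingType) (delta : 'I_s -> A -> A)
    (alpha : multi_index) (a : A) : A :=
  foldr (fun i => iter (alpha i) (delta i)) a (enum 'I_s).

Definition nil_filtration (A : pzRingType) (delta : 'I_s -> A -> A) (n : nat)
    : set A :=
  [set a | forall alpha, (n < mi_deg alpha)%N -> delta_pow delta alpha a = 0].

(* [U = \bigoplus_(alpha | P alpha) B x^alpha] and
   [U = \bigoplus_(alpha | P alpha) x^alpha B], as free B-modules on the
   monomials: every element of U has a finite expansion, and expansions of 0
   have zero coefficients (hence, B being additive, expansions are unique). *)
Definition free_direct_sum (Q : pzRingType) (B : set Q)
    (term : multi_index -> Q -> Q) (P : pred multi_index) (U : set Q) : Prop :=
  (forall q, U q <-> exists (E : seq multi_index) (b : multi_index -> Q),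
     [/\ uniq E, {in E, forall alpha, P alpha /\ B (b alpha)}
       & q = \sum_(alpha <- E) term alpha (b alpha)]) /\
  (forall (E : seq multi_index) (b : multi_index -> Q),
     uniq E -> {in E, forall alpha, P alpha /\ B (b alpha)} ->
     \sum_(alpha <- E) term alpha (b alpha) = 0 ->
     {in E, forall alpha, b alpha = 0}).

Definition left_monomial_sum (Q : pzRingType) (B : set Q) (x : 'I_s -> Q) :=
  free_direct_sum B (fun alpha b => b * monomial x alpha).

Definition right_monomial_sum (Q : pzRingType) (B : set Q) (x : 'I_s -> Q) :=
  free_direct_sum B (fun alpha b => monomial x alpha * b).

End Families.

(* T = R[x; d] inside Q: T is freely generated as a ring over its subring R by
   x subject to x r = r x + d(r).  Here f and g are only relevant on R and T. *)
Definition ore_extension (Q : pzRingType) (R T : set Q) (x : Q) (d : Q -> Q)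
    : Prop :=
  [/\ [/\ subring R, subring T, R `<=` T & T x],
      ring_derivation_on R d,
      forall r, R r -> x * r = r * x + d r
    & forall (T' : pzRingType) (f : Q -> T') (y : T'),
        ring_morphism_on R f ->
        (forall r, R r -> y * f r = f r * y + f (d r)) ->
        let extends (g : Q -> T') :=
          [/\ ring_morphism_on T g, forall r, R r -> g r = f r & g x = y] in
        exists2 g, extends g &
          forall g', extends g' -> forall t, T t -> g' t = g t].

(* Q = B[x_1; d_1]...[x_s; d_s], where d_i is the restriction of ad(x_i) to
   B[x_1; d_1]...[x_{i-1}; d_{i-1}]. *)
Definition iterated_ore_extension (Q : pzRingType) (s : nat) (B : set Q)
    (x : 'I_s -> Q) : Prop :=
  exists R : nat -> set Q,
    [/\ R 0%N = B, R s = setT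
      & forall i : 'I_s, ore_extension (R i) (R i.+1) (x i) (ad (x i))].

Definition ad_stable (Q : pzRingType) (s : nat) (B : set Q) (x : 'I_s -> Q)
    : Prop :=
  (forall i b, B b -> B (ad (x i) b)) /\ (forall i k, B (ad (x i) (x k))).

Definition formal_partials (K : fieldType) (Q : algType K) (s : nat)
    (B : set Q) (x : 'I_s -> Q) (p : 'I_s -> Q -> Q) : Prop :=
  forall i, [/\ derivation (p i), forall b, B b -> p i b = 0
              & forall k, p i (x k) = (i == k)%:R].

(* Main.v *)
Require Import Defs.
From HB Require Import structures.
From mathcomp Require Import all_boot all_order all_algebra.
From mathcomp Require Import boolp classical_sets.
Import GRing.Theory.
Local Open Scope classical_set_scope.
Local Open Scope ring_scope.

(* Let S consist of regular elements killed by commuting locally nilpotent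
   delta_i, with y_i in A satisfying delta_i(y_i) = s_i in S and
   delta_k(y_i) = 0 for k <> i.  The delta_i extend to S^{-1}A, and
   x_i = s_i^{-1} y_i satisfies delta_k(x_i) = 1 if k = i and 0 otherwise.  In
   characteristic zero, a locally nilpotent derivation d with d(x) = 1 makes a
   ring T free over ker d on the powers of x (integrate d(t) and induct on the
   nilpotency index), so T = (ker d)[x; ad x]; the iterated Ore extension comes
   from the chain of rings killed by delta_i, ..., delta_s.  The direct sums
   over multi-indices come from Taylor's formula: if t is killed by all
   delta^beta with |beta| > n, subtract the terms
   (delta^alpha(t) / alpha!) x^alpha with |alpha| = n.  Conversely, the formal
   partial derivatives commute and are locally nilpotent because these
   properties define subrings containing B and the x_i, and writing
   x_i = s_i^{-1} a_i with a_i in A gives partial_i(a_i) = s_i in S. *)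

Set Implicit Arguments.
Unset Strict Implicit.
Unset Printing Implicit Defensive.

(** * Left localization *)

Section Localization.
Variables (K : fieldType) (A : algType K) (S : set A).

(* The graph of right multiplication by s^{-1} a, i.e. the pairs (x, y) of
   elements of A with x s^{-1} a = y. *)
Definition frac (s a x y : A) : Prop :=
  exists t c, [/\ S t, t * x = c * s & t * y = c * a].

(* The proofs oreS and regS are parameters so that the canonical ring structure,
   whose operations need them, can be inferred from the type. *)
Record localization (oreS : left_ore_set S)
    (regS : S `<=` regular_elements A) :=
  Localization {
    graph :> A -> A -> Prop;
    graphP : exists s a, S s /\ graph = frac s a }.

Hypotheses (oreS : left_ore_set S) (regS : S `<=` regular_elements A).

Local Notation Q := (localization oreS regS).

Let S1 : S 1. Proof. by case: oreS. Qed.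
Let SM s t : S s -> S t -> S (s * t). Proof. by case: oreS => _ + _; apply. Qed.
Let ore a s : S s -> exists a' s', S s' /\ s' * a = a' * s.
Proof. by case: oreS => _ _; apply. Qed.
Let SI s x y : S s -> s * x = s * y -> x = y.
Proof. by move=> /regS[+ _]; apply. Qed.
Let IS s x y : S s -> x * s = y * s -> x = y.
Proof. by move=> /regS[_]; apply. Qed.

Lemma frac_self s a : frac s a s a.
Proof. by exists 1, 1; rewrite !mul1r; split. Qed.

(** The Ore condition gives [t' * t = a' * u] for the two left factors. Then [t' * c] and [a' * d]
    agree after multiplication by [s], hence agree because [s] is regular, and [t' * t] cancels on
    the left. *)
Lemma frac_fun (F : Q) x y z : F x y -> F x z -> y = z.
Proof.
have [s [a [Ss ->]]] := graphP F.
move=> [t [c [St tx ty]]] [u [d [Su ux uz]]].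
have [a' [t' [St' e]]] := ore t Su.
apply: (SI (SM St' St)); rewrite {2}e -!mulrA ty uz mulrA [RHS]mulrA.
congr (_ * _); apply: (IS Ss).
by rewrite -!mulrA -tx -ux !mulrA e.
Qed.

Lemma fracB (F : Q) x y x' y' : F x y -> F x' y' -> F (x - x') (y - y').
Proof.
have [s [a [Ss ->]]] := graphP F.
move=> [t [c [St tx ty]]] [u [d [Su ux uz]]].
have [a' [t' [St' e]]] := ore t Su.
exists (t' * t), (t' * c - a' * d); split; first exact: SM.
  by rewrite mulrBr mulrBl {2}e -!mulrA tx ux.
by rewrite mulrBr mulrBl {2}e -!mulrA ty uz.
Qed.

Lemma fracD (F : Q) x y x' y' : F x y -> F x' y' -> F (x + x') (y + y').
Proof.
move=> Fxy Fxy'; rewrite -[x']opprK -[y']opprK; apply: fracB Fxy _.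
by rewrite -[- x']sub0r -[- y']sub0r -{1}(subrr x') -{1}(subrr y');
  do ?apply: fracB.
Qed.

Lemma fracM (F : Q) c x y : F x y -> F (c * x) (c * y).
Proof.
have [s [a [Ss ->]]] := graphP F.
move=> [t [d [St tx ty]]].
have [c' [t' [St' e]]] := ore c St.
exists t', (c' * d); split => //.
  by rewrite mulrA e -!mulrA tx.
by rewrite mulrA e -!mulrA ty.
Qed.

Lemma fracV (F : Q) t x y : S t -> F (t * x) (t * y) -> F x y.
Proof.
have [s [a [Ss ->]]] := graphP F => St.
move=> [u [d [Su ux uy]]].
by exists (u * t), d; rewrite -!mulrA; split=> //; apply: SM.
Qed.

Lemma frac_dense (F : Q) x : exists t y, S t /\ F (t * x) y.
Proof.
have [s [a [Ss ->]]] := graphP F.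
have [c [t [St e]]] := ore x Ss.
by exists t, (c * a); split=> //; exists 1, c; rewrite !mul1r e; split.
Qed.

Lemma frac_dense2 (F G : Q) : exists s a b, [/\ S s, F s a & G s b].
Proof.
have [s [a [Ss Fsa]]] := frac_dense F 1; rewrite mulr1 in Fsa.
have [t [b [St Gtb]]] := frac_dense G s.
by exists (t * s), (t * a), b; split=> //; [exact: SM | exact: fracM].
Qed.

Lemma frac_cross (F : Q) s a x y t c :
  F s a -> F x y -> t * x = c * s -> t * y = c * a.
Proof.
move=> Fsa Fxy e; apply: (frac_fun (F := F) (x := t * x)); first exact: fracM.
by rewrite e; apply: fracM.
Qed.

Lemma frac_sub s a (F : Q) x y : F s a -> frac s a x y -> F x y.
Proof.
move=> Fsa [t [c [St tx ty]]]; apply: (fracV St).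
by rewrite tx ty; apply: fracM.
Qed.

Lemma sub_frac s a (F : Q) x y : S s -> F s a -> F x y -> frac s a x y.
Proof.
move=> Ss Fsa Fxy; have [c [t [St e]]] := ore x Ss.
by exists t, c; split=> //; apply: frac_cross Fsa Fxy e.
Qed.

Lemma graph_inj (F G : Q) : graph F = graph G -> F = G.
Proof.
case: F G => [F HF] [G HG] /= E; rewrite E in HF *.
by congr Localization; apply: Prop_irrelevance.
Qed.

(** A graph is recovered from any one of its points [(s, a)] with [s] in [S]: it equals [frac s a].
    Each ring identity below is therefore checked at a single point where both sides can be
    computed. *)
Lemma localization_eq s a (F G : Q) : S s -> F s a -> G s a -> F = G.
Proof.
move=> Ss Fsa Gsa; apply: graph_inj; apply/funext => x; apply/funext => y.
by apply/propext; split=> [/(sub_frac Ss Fsa)|/(sub_frac Ss Gsa)];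
  apply: frac_sub.
Qed.

Definition loc_frac s a (Ss : S s) : Q :=
  @Localization oreS regS (frac s a)
    (ex_intro _ s (ex_intro _ a (conj Ss erefl))).

(** Sums are pointwise; a common denominator supplies the point that determines the sum. *)
Lemma loc_add_subproof (F G : Q) : exists H : Q,
  forall x y z, F x y -> G x z -> H x (y + z).
Proof.
have [s [a [b [Ss Fsa Gsb]]]] := frac_dense2 F G.
exists (loc_frac (a + b) Ss) => x y z Fxy Gxz.
have [c [t [St e]]] := ore x Ss.
exists t, c; split=> //; rewrite !mulrDr.
by rewrite (frac_cross Fsa Fxy e) (frac_cross Gsb Gxz e).
Qed.

(** Graphs stand for right multiplications, so the product is [F] followed by [G]. The factor [t]
    moves the value [a] of [F] into the domain of [G]. *)
Lemma loc_mul_subproof (F G : Q) : exists H : Q,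
  forall x y z, F x y -> G y z -> H x z.
Proof.
have [s [a [Ss Fsa]]] := frac_dense F 1; rewrite mulr1 in Fsa.
have [t [b [St Gtb]]] := frac_dense G a.
have Fts := fracM t Fsa.
exists (loc_frac b (SM St Ss)) => x y z Fxy Gyz.
have [c [u [Su e]]] := ore x (SM St Ss).
exists u, c; split=> //.
exact: frac_cross Gtb Gyz (frac_cross Fts Fxy e).
Qed.

Lemma loc_opp_subproof (F : Q) : exists H : Q,
  forall x y, F x y -> H x (- y).
Proof.
have [s [a [Ss Fsa]]] := frac_dense F 1; rewrite mulr1 in Fsa.
exists (loc_frac (- a) Ss) => x y Fxy.
have [t [c [St tx ty]]] := sub_frac Ss Fsa Fxy.
by exists t, c; rewrite tx !mulrN ty.
Qed.

Definition loc_add F G := projT1 (cid (loc_add_subproof F G)).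
Definition loc_mul F G := projT1 (cid (loc_mul_subproof F G)).
Definition loc_opp F := projT1 (cid (loc_opp_subproof F)).
Definition loc_of a : Q := loc_frac a S1.

Lemma loc_addP (F G : Q) x y z : F x y -> G x z -> loc_add F G x (y + z).
Proof. exact: (projT2 (cid (loc_add_subproof F G))). Qed.

Lemma loc_mulP (F G : Q) x y z : F x y -> G y z -> loc_mul F G x z.
Proof. exact: (projT2 (cid (loc_mul_subproof F G))). Qed.

Lemma loc_oppP (F : Q) x y : F x y -> loc_opp F x (- y).
Proof. exact: (projT2 (cid (loc_opp_subproof F))). Qed.

Lemma loc_ofP a x : loc_of a x (x * a).
Proof. by exists 1, x; rewrite !mul1r mulr1; split. Qed.

HB.instance Definition _ := gen_eqMixin Q.
HB.instance Definition _ := gen_choiceMixin Q.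

Lemma loc_addA : associative loc_add.
Proof.
move=> F G H; have [s [a [b [Ss Fsa Gsb]]]] := frac_dense2 F G.
have [t [c [St Htc]]] := frac_dense H s.
have Fta := fracM t Fsa; have Gtb := fracM t Gsb.
apply: (localization_eq (SM St Ss) (loc_addP Fta (loc_addP Gtb Htc))).
by rewrite addrA; do ?apply: loc_addP.
Qed.

Lemma loc_addC : commutative loc_add.
Proof.
move=> F G; have [s [a [b [Ss Fsa Gsb]]]] := frac_dense2 F G.
apply: (localization_eq Ss (loc_addP Fsa Gsb)).
by rewrite addrC; apply: loc_addP.
Qed.

Lemma loc_add0 : left_id (loc_of 0) loc_add.
Proof.
move=> F; have [s [a [Ss Fsa]]] := frac_dense F 1; rewrite mulr1 in Fsa.
apply: (localization_eq Ss _ Fsa).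
by have := loc_addP (loc_ofP 0 s) Fsa; rewrite mulr0 add0r.
Qed.

Lemma loc_addN : left_inverse (loc_of 0) loc_opp loc_add.
Proof.
move=> F; have [s [a [Ss Fsa]]] := frac_dense F 1; rewrite mulr1 in Fsa.
apply: (localization_eq Ss (loc_addP (loc_oppP Fsa) Fsa)).
by rewrite addNr -[X in graph _ _ X](mulr0 s); apply: loc_ofP.
Qed.

HB.instance Definition _ :=
  GRing.isZmodule.Build Q loc_addA loc_addC loc_add0 loc_addN.

Lemma loc_mulA : associative loc_mul.
Proof.
move=> F G H.
have [s [a [Ss Fsa]]] := frac_dense F 1; rewrite mulr1 in Fsa.
have [t [b [St Gtb]]] := frac_dense G a.
have [u [c [Su Huc]]] := frac_dense H b.
have Gut := fracM u Gtb.
have Fut := fracM u (fracM t Fsa).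
apply: (localization_eq (SM Su (SM St Ss))).
  exact: loc_mulP Fut (loc_mulP Gut Huc).
exact: loc_mulP (loc_mulP Fut Gut) Huc.
Qed.

Lemma loc_mul1l : left_id (loc_of 1) loc_mul.
Proof.
move=> F; have [s [a [Ss Fsa]]] := frac_dense F 1; rewrite mulr1 in Fsa.
apply: (localization_eq Ss (loc_mulP (loc_ofP 1 s) _) Fsa).
by rewrite mulr1.
Qed.

Lemma loc_mul1r : right_id (loc_of 1) loc_mul.
Proof.
move=> F; have [s [a [Ss Fsa]]] := frac_dense F 1; rewrite mulr1 in Fsa.
apply: (localization_eq Ss _ Fsa).
by have := loc_mulP Fsa (loc_ofP 1 a); rewrite mulr1.
Qed.

Lemma loc_mulDl : left_distributive loc_mul loc_add.
Proof.
move=> F G H; have [s [a [b [Ss Fsa Gsb]]]] := frac_dense2 F G.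
(* First [t] brings [a], then [u] brings [t * b] into the domain of [H]; after scaling by [u * t]
   all the terms are defined at one point. *)
have [t [c [St Htc]]] := frac_dense H a.
have [u [d [Su Hud]]] := frac_dense H (t * b).
have Huc := fracM u Htc.
have Fu := fracM u (fracM t Fsa); have Gu := fracM u (fracM t Gsb).
apply: (localization_eq (SM Su (SM St Ss))).
  exact: loc_mulP (loc_addP Fu Gu) (fracD Huc Hud).
by apply: loc_addP; [apply: loc_mulP Fu _ | apply: loc_mulP Gu _].
Qed.

Lemma loc_mulDr : right_distributive loc_mul loc_add.
Proof.
move=> F G H; have [s [a [Ss Fsa]]] := frac_dense F 1; rewrite mulr1 in Fsa.
have [t [b [St Gtb]]] := frac_dense G a.
have [u [c [Su Huc]]] := frac_dense H (t * a).
have Gub := fracM u Gtb; have Fu := fracM u (fracM t Fsa).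
apply: (localization_eq (SM Su (SM St Ss))).
  exact: loc_mulP Fu (loc_addP Gub Huc).
by apply: loc_addP; apply: loc_mulP Fu _.
Qed.

HB.instance Definition _ :=
  GRing.Zmodule_isPzRing.Build Q loc_mulA loc_mul1l loc_mul1r loc_mulDl
    loc_mulDr.

Lemma loc_of_inj : injective loc_of.
Proof.
move=> a b E; have := loc_ofP a 1; rewrite E !mul1r => h.
by apply: (frac_fun h); rewrite -[b in X in _ X]mul1r; apply: loc_ofP.
Qed.

Lemma loc_one_neq0 : (1 : Q) != 0.
Proof. by apply/eqP => /loc_of_inj/eqP; rewrite oner_eq0. Qed.

HB.instance Definition _ := GRing.PzSemiRing_isNonZero.Build Q loc_one_neq0.

Lemma loc_of_is_additive : zmod_morphism loc_of.
Proof.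
move=> a b; apply: (localization_eq S1 (loc_ofP _ _)).
by rewrite mulrBr; apply: loc_addP (loc_ofP _ _) (loc_oppP (loc_ofP _ _)).
Qed.

Lemma loc_of_is_multiplicative : monoid_morphism loc_of.
Proof.
split=> // a b; apply: (localization_eq S1 (loc_ofP _ _)).
by apply: loc_mulP (loc_ofP _ _) _; rewrite mulrA; apply: loc_ofP.
Qed.

HB.instance Definition _ :=
  GRing.isZmodMorphism.Build A Q loc_of loc_of_is_additive.
HB.instance Definition _ :=
  GRing.isMonoidMorphism.Build A Q loc_of loc_of_is_multiplicative.

Definition loc_scale (k : K) (F : Q) : Q := loc_of k%:A * F.

Lemma loc_scaleA k l F : loc_scale k (loc_scale l F) = loc_scale (k * l) F.
Proof. by rewrite /loc_scale mulrA -rmorphM /= -scalerAl mul1r scalerA. Qed.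

Lemma loc_scale1 : left_id 1 loc_scale.
Proof. by move=> F; rewrite /loc_scale scale1r rmorph1 mul1r. Qed.

Lemma loc_scaleDr : right_distributive loc_scale +%R.
Proof. by move=> k F G; rewrite /loc_scale mulrDr. Qed.

Lemma loc_scaleDl F : {morph loc_scale^~ F : k l / k + l}.
Proof. by move=> k l; rewrite /loc_scale scalerDl rmorphD /= mulrDl. Qed.

HB.instance Definition _ := GRing.Zmodule_isLmodule.Build K Q
  loc_scaleA loc_scale1 loc_scaleDr loc_scaleDl.

Lemma loc_scaleAl (k : K) (F G : Q) : k *: (F * G) = k *: F * G.
Proof. by rewrite /GRing.scale /= /loc_scale mulrA. Qed.

HB.instance Definition _ := GRing.Lmodule_isLalgebra.Build K Q loc_scaleAl.

(** The scalar [k%:A] is central in [A]; evaluation at a denominator of [F] shows that its image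
    commutes with every fraction. *)
Lemma loc_scaleAr (k : K) (F G : Q) : k *: (F * G) = F * (k *: G).
Proof.
rewrite /GRing.scale /= /loc_scale !mulrA; congr (_ * _).
have [s [a [Ss Fsa]]] := frac_dense F 1; rewrite mulr1 in Fsa.
have Fk := fracM (k%:A) Fsa.
have comm (b : A) : b * k%:A = k%:A * b.
  by rewrite -scalerAl -scalerAr mul1r mulr1.
apply: (localization_eq Ss (a := k%:A * a)).
  by apply: loc_mulP (loc_ofP _ _) _; rewrite comm.
by rewrite -comm; apply: loc_mulP Fsa (loc_ofP _ _).
Qed.

HB.instance Definition _ := GRing.Lalgebra_isAlgebra.Build K Q loc_scaleAr.

Lemma loc_of_is_scalable : scalable loc_of.
Proof.
by move=> k a; rewrite /GRing.scale /= /loc_scale -rmorphM /= -scalerAl mul1r.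
Qed.

HB.instance Definition _ :=
  GRing.isScalable.Build K A Q *:%R loc_of loc_of_is_scalable.

Lemma loc_of_left_localization : left_localization S (loc_of : A -> Q).
Proof.
have inv s (Ss : S s) : inverse_of (loc_of s) (loc_frac 1 Ss).
  have fs : loc_frac 1 Ss s 1 := frac_self s 1.
  split.
    apply: (localization_eq Ss (loc_mulP fs (loc_ofP _ _))).
    by have := loc_ofP 1 s; rewrite mul1r mulr1.
  apply: (localization_eq S1 (loc_mulP (loc_ofP _ _) _) (loc_ofP _ _)).
  by rewrite !mul1r.
split=> [s Ss||a]; first by exists (loc_frac 1 Ss).
  apply/seteqP; split=> // F _.
  have [s [a [Ss Fsa]]] := frac_dense F 1; rewrite mulr1 in Fsa.
  exists s, a, (loc_frac 1 Ss); split=> //.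
  apply: (localization_eq Ss Fsa);
  apply: (loc_mulP (F := loc_frac 1 Ss) (frac_self _ _)).
  by have := loc_ofP a 1; rewrite mul1r.
split=> [|[s Ss]]; last first.
  by rewrite -(mulr0 s) => /(SI Ss) ->; rewrite rmorph0.
by rewrite -(rmorph0 loc_of) => /loc_of_inj ->; exists 1; rewrite ?mulr0.
Qed.

End Localization.

Lemma left_localization_exists (K : fieldType) (A : algType K) (S : set A) :
  left_ore_set S -> S `<=` regular_elements A ->
  exists (Q : algType K) (j : {lrmorphism A -> Q}), left_localization S j.
Proof.
move=> oreS regS; exists (localization oreS regS : algType K).
by exists (loc_of oreS regS : {lrmorphism A -> _});
  apply: loc_of_left_localization.
Qed.

(** * Derivations and subrings *)

Section Derivation.
Variables (K : fieldType) (A : algType K) (d : A -> A).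
Hypothesis der_d : derivation d.

Lemma derM a b : d (a * b) = d a * b + a * d b.
Proof. by case: der_d => _; apply. Qed.

Lemma derZ_add k a b : d (k *: a + b) = k *: d a + d b.
Proof. by case: der_d => + _; apply. Qed.

Lemma derD a b : d (a + b) = d a + d b.
Proof. by have := derZ_add 1 a b; rewrite !scale1r. Qed.

Lemma der0 : d 0 = 0.
Proof. by apply: (addrI (d 0)); rewrite -derD !addr0. Qed.

Lemma derZ k a : d (k *: a) = k *: d a.
Proof. by rewrite -[k *: a]addr0 derZ_add der0 addr0. Qed.

Lemma derN a : d (- a) = - d a.
Proof. by rewrite -!scaleN1r derZ. Qed.

Lemma derB a b : d (a - b) = d a - d b.
Proof. by rewrite derD derN. Qed.

Lemma der1 : d 1 = 0.
Proof.
by apply: (addrI (d 1)); rewrite addr0 -[in RHS](mulr1 1) derM mulr1 mul1r.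
Qed.

Lemma derMn a n : d (a *+ n) = d a *+ n.
Proof. by elim: n => [|n IHn]; rewrite ?der0 // !mulrS derD IHn. Qed.

Lemma der_exp x n : d x = 1 -> d (x ^+ n) = x ^+ n.-1 *+ n.
Proof.
move=> dx; elim: n => [|n IHn]; first by rewrite expr0 der1.
rewrite exprS derM dx mul1r IHn mulrS; case: n {IHn} => [|n] /=.
  by rewrite !mulr0n mulr0.
by rewrite mulrnAr -exprS.
Qed.

Lemma iter_der0 n : iter n d 0 = 0.
Proof. by elim: n => //= n ->; rewrite der0. Qed.

Lemma iter_derD n a b : iter n d (a + b) = iter n d a + iter n d b.
Proof. by elim: n => //= n ->; rewrite derD. Qed.

Lemma iter_derB n a b : iter n d (a - b) = iter n d a - iter n d b.
Proof. by elim: n => //= n ->; rewrite derB. Qed.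

Lemma iter_der_eq0_le m n a : (m <= n)%N -> iter m d a = 0 -> iter n d a = 0.
Proof. by move=> /subnK <- e; rewrite iterD e iter_der0. Qed.

(** Each term of d(ab) = d(a)b + a d(b) lowers one of the two indices, whence an induction on
    [m + n]. This closes the elements on which d is nilpotent under products. *)
Lemma iter_derM_eq0 m n a b :
  iter m d a = 0 -> iter n d b = 0 -> iter (m + n) d (a * b) = 0.
Proof.
have [N leN] := ubnP (m + n); elim: N => // N IHN in m n a b leN *.
case: m leN => [|m] leN; first by move=> a0 _; rewrite [a]a0 mul0r iter_der0.
case: n leN => [|n] leN; first by move=> _ b0; rewrite [b]b0 mulr0 iter_der0.
move=> am bn; rewrite addSn iterSr derM iter_derD.
rewrite (IHN m n.+1 (d a) b) -?iterSr // add0r -addSnnS.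
by rewrite (IHN m.+1 n a (d b)) -?iterSr // addSnnS.
Qed.

Lemma der_inverse q u : inverse_of q u -> d q = 0 -> d u = 0.
Proof.
move=> [uq qu] dq; have := der1; rewrite -uq derM dq mulr0 addr0 => e.
by rewrite -[d u]mulr1 -qu mulrA e mul0r.
Qed.

End Derivation.

Lemma subring0 (Q : pzRingType) (P : set Q) : subring P -> P 0.
Proof. by case=> P1 PB _; rewrite -(subrr 1); apply: PB. Qed.

Lemma subringN (Q : pzRingType) (P : set Q) a : subring P -> P a -> P (- a).
Proof.
by move=> sP Pa; rewrite -sub0r; case: (sP) => _ + _; apply=> //;
  apply: subring0.
Qed.

Lemma subringD (Q : pzRingType) (P : set Q) a b :
  subring P -> P a -> P b -> P (a + b).
Proof.
move=> sP Pa Pb; rewrite -[b]opprK; case: (sP) => _ + _; apply=> //.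
exact: subringN.
Qed.

Lemma subringM (Q : pzRingType) (P : set Q) a b :
  subring P -> P a -> P b -> P (a * b).
Proof. by case=> _ _; apply. Qed.

Lemma subringI (Q : pzRingType) (P R : set Q) :
  subring P -> subring R -> subring (P `&` R).
Proof.
move=> [P1 PB PM] [R1 RB RM].
by split=> [//|a b [? ?] [? ?]|a b [? ?] [? ?]]; split; auto.
Qed.

Section CommonKernel.
Variables (K : fieldType) (Q : algType K) (s : nat) (delta : 'I_s -> Q -> Q).
Hypothesis der : forall i, derivation (delta i).

(** The predicate selects part of the family: all indices give the constants, and the indices above
    i give a ring in the tower of Ore extensions. *)
Lemma subring_kernel (P : pred 'I_s) :
  subring [set q | forall i, P i -> delta i q = 0].
Proof.
split=> [i _|a b a0 b0 i Pi|a b a0 b0 i Pi]; first by rewrite (der1 (der i)).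
  by rewrite (derB (der i)) a0 // b0 // subrr.
by rewrite (derM (der i)) a0 // b0 // mul0r mulr0 addr0.
Qed.

Lemma subalgebra_common_kernel : subalgebra (common_kernel delta).
Proof.
split; last by move=> k b bC i; rewrite (derZ (der i)) bC scaler0.
suff -> : common_kernel delta = [set q | forall i, xpredT i -> delta i q = 0].
  exact: subring_kernel.
by apply/seteqP; split=> q h i => [_|]; apply: h.
Qed.

End CommonKernel.

(** * Extension of derivations to the localization *)

Section ExtendDerivation.
Variables (K : fieldType) (A Q : algType K) (S : set A).
Variable j : {lrmorphism A -> Q}.
Hypotheses (oreS : left_ore_set S) (regS : S `<=` regular_elements A).
Hypothesis locj : left_localization S j.

Lemma left_localization_inj : injective j.
Proof.
case: locj => _ _ tors a b e; apply/eqP; rewrite -subr_eq0; apply/eqP.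
have /tors[s /regS[reg _] sab] : j (a - b) = 0 by rewrite rmorphB /= e subrr.
by apply: reg; rewrite /= mulr0.
Qed.

Lemma left_localization_cancel s q r : S s -> j s * q = j s * r -> q = r.
Proof.
case: locj => inv _ _ /inv[u [us _]] e.
by rewrite -[q]mul1r -[r]mul1r -us -!mulrA e.
Qed.

Lemma left_localization_num q : exists s a, S s /\ j s * q = j a.
Proof.
case: locj => _ fr _; have : setT q by [].
rewrite -fr => -[s [a [u [Ss _ [_ su] ->]]]].
by exists s, a; rewrite mulrA su mul1r.
Qed.

Lemma left_localization_num2 q r :
  exists s a b, [/\ S s, j s * q = j a & j s * r = j b].
Proof.
have [s [a [Ss sq]]] := left_localization_num q.
have [t [b [St tr]]] := left_localization_num r.
case: oreS => _ SM /(_ t s Ss)[c [u [Su e]]].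
exists (u * t), (c * a), (u * b); split; first exact: SM.
  by rewrite e !rmorphM /= -mulrA sq.
by rewrite !rmorphM /= -mulrA tr.
Qed.

Variable d : A -> A.
Hypotheses (der_d : derivation d) (dS : forall s, S s -> d s = 0).

(** Since d kills [S], the only possible value at s^{-1}a is s^{-1}d(a). *)
Lemma derivation_extends : exists d' : Q -> Q,
  derivation d' /\ forall a, d' (j a) = j (d a).
Proof.
have [S1 SM ore] := oreS.
have [d' d'P] : {d' : Q -> Q & forall q, exists s a,
    [/\ S s, j s * q = j a & j s * d' q = j (d a)]}.
  apply: (choice (P := fun q r => exists s a,
    [/\ S s, j s * q = j a & j s * r = j (d a)])) => q.
  have [s [a [Ss sq]]] := left_localization_num q.
  case: locj => /(_ s Ss)[u [_ su]] _ _.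
  by exists (u * j (d a)), s, a; rewrite mulrA su mul1r.
(* Independence of the representative: with [u * s = c * t], applying d gives 0 = d(c)t, so d(c) = 0
   by regularity of t. Applying d to [u * a = c * b] then compares the two values. *)
have star s a q : S s -> j s * q = j a -> j s * d' q = j (d a).
  move=> Ss sq; have [t [b [St tq tdq]]] := d'P q.
  have [c [u [Su e]]] := ore s t St.
  have dc : d c = 0.
    have [_] := regS St; apply; rewrite /= mul0r.
    have := dS (SM _ _ Su Ss); rewrite e (derM der_d) (dS St) mulr0.
    by rewrite addr0.
  have ua : u * a = c * b.
    by apply: left_localization_inj;
      rewrite !rmorphM /= -sq -tq !mulrA -!rmorphM /= e.
  apply: (left_localization_cancel Su).
  rewrite mulrA -!rmorphM /= e rmorphM /= -mulrA tdq -rmorphM.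
  congr (j _); have := congr1 d ua.
  by rewrite !(derM der_d) dc (dS Su) !mul0r !add0r.
exists d'; split; last by move=> a; have := star 1 a (j a) S1;
  rewrite rmorph1 !mul1r; apply.
split=> [k q r|q r _ _].
  have [s [a [b [Ss sq sr]]]] := left_localization_num2 q r.
  apply: (left_localization_cancel Ss).
  rewrite (star _ (k *: a + b) _ Ss); last first.
    by rewrite mulrDr -scalerAr sq sr linearP.
  rewrite (derZ_add der_d) mulrDr -scalerAr (star _ _ _ Ss sq)
    (star _ _ _ Ss sr).
  by rewrite linearP.
have [s [a [Ss sq]]] := left_localization_num q.
have [t [b [St tr]]] := left_localization_num r.
(* From sq = a, tr = b and ua = ct follows (us)qr = cb, so [u * s] is a denominator of the
   product. *)
have [c [u [Su e]]] := ore a t St.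
have Sus := SM _ _ Su Ss; apply: (left_localization_cancel Sus).
have usq : j (u * s) * q = j (c * t) by rewrite rmorphM /= -mulrA sq -rmorphM e.
rewrite (star _ (c * b)) //; last first.
  by rewrite mulrA usq rmorphM /= -mulrA tr -rmorphM.
rewrite mulrDr !mulrA usq (star _ _ _ Sus usq) !(derM der_d) (dS St) mulr0
  addr0.
by rewrite !rmorphD !rmorphM /= -!mulrA tr (star _ b).
Qed.

End ExtendDerivation.

Section Subring.
Variables (Q : pzRingType) (P : set Q).

Definition subring_type (sP : subring P) := {q : Q | `[< P q >]}.

Hypothesis sP : subring P.
Local Notation T := (subring_type sP).

Fact subring_pred_closed : subring_closed (fun q => `[< P q >]).
Proof.
case: sP => P1 PB PM;
split=> [|a b /asboolP Pa /asboolP Pb|a b /asboolP Pa /asboolP Pb].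
- exact/asboolP.
- exact/asboolP/PB.
- exact/asboolP/PM.
Qed.

HB.instance Definition _ := SubType.on T.
HB.instance Definition _ := Choice.on T.
HB.instance Definition _ :=
  GRing.SubChoice_isSubPzRing.Build Q (fun q => `[< P q >]) T
    subring_pred_closed.
End Subring.

(** The universal property of an Ore extension ranges over ring types, so a subset must become such
    a type before it can serve as a target. *)
Lemma subring_ring_exists (Q : pzRingType) (P : set Q) : subring P ->
  exists (T : pzRingType) (i : {rmorphism T -> Q}),
    injective i /\ forall q, P q <-> exists t, i t = q.
Proof.
move=> sP; exists (subring_type sP : pzRingType).
exists (val : {rmorphism (subring_type sP : pzRingType) -> Q}); split;
  first exact: val_inj.
move=> q; split=> [Pq|[t <-]]; last by apply/asboolP/(valP t).
by exists (exist (fun q => `[< P q >]) q (asboolT Pq)).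
Qed.

(** * Generation of Ore extensions *)

(* The universal property gives a ring morphism T -> P :&: T fixing R and x,
   and its uniqueness part says that composing with the inclusion into Q
   yields the identity of T. *)
Lemma ore_extension_generated (Q : pzRingType) (R T P : set Q) x d :
  ore_extension R T x d -> subring P -> R `<=` P -> P x -> T `<=` P.
Proof.
move=> [[sR sT RT Tx] [Rd _ _] comm univ] sP RP Px t Tt.
have RD a b := @subringD _ _ a b sR; have RM a b := @subringM _ _ a b sR.
have [R1 _ _] := sR.
have [T0 [i [i_inj iP]]] := subring_ring_exists (subringI sP sT).
have [f fP] : {f : Q -> T0 & forall q, (P `&` T) q -> i (f q) = q}.
  apply: (choice (P := fun q z => (P `&` T) q -> i z = q)) => q.
  have [/iP[z zq]|nPq] := pselect ((P `&` T) q); first by exists z.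
  by exists 0 => /nPq.
have fR r : R r -> i (f r) = r by move=> Rr; apply: fP; split; auto.
have fx : i (f x) = x by apply: fP.
have f_mor : ring_morphism_on R f.
  split=> [|a b Ra Rb|a b Ra Rb]; apply: i_inj.
  - by rewrite fR // rmorph1.
  - by rewrite rmorphD /= !fR //; apply: RD.
  - by rewrite rmorphM /= !fR //; apply: RM.
have f_comm r : R r -> f x * f r = f r * f x + f (d r).
  move=> Rr; apply: i_inj; rewrite rmorphD !rmorphM /= fx !fR ?comm //.
  exact: Rd.
have [g [[g1 gD gM] gR gx] _] := univ _ _ _ f_mor f_comm.
have id_mor : ring_morphism_on R (@id Q) by [].
have [h _ h_uniq] := univ _ _ x id_mor comm.
have gt : i (g t) = t.
  rewrite [RHS](h_uniq id) //; apply: (h_uniq (fun q => i (g q))) => //.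
  split=> [|r Rr|]; [|by rewrite gR ?fR|by rewrite gx fx].
  split=> [|a b Ta Tb|a b Ta Tb]; first by rewrite g1 rmorph1.
    by rewrite gD // rmorphD.
  by rewrite gM // rmorphM.
suff [] : (P `&` T) t by [].
by apply/iP; exists (g t).
Qed.

(** An induction principle: a property that defines a subring holds everywhere once it holds on [B]
    and on the variables. *)
Lemma iterated_ore_generated (Q : pzRingType) s (B P : set Q) (x : 'I_s -> Q) :
  iterated_ore_extension B x -> subring P -> B `<=` P -> (forall i, P (x i)) ->
  forall q, P q.
Proof.
move=> [R [R0 Rs ext]] sP BP Px q.
suff RP n : (n <= s)%N -> R n `<=` P by apply: (RP s) => //; rewrite Rs.
elim: n => [_|n IHn lt_ns]; first by rewrite R0.
exact: ore_extension_generated (ext (Ordinal lt_ns)) sP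
  (IHn (ltnW lt_ns)) (Px _).
Qed.

(** * Formal partial derivatives *)

Section FormalPartials.
Variables (K : fieldType) (Q : algType K) (s : nat) (B : set Q).
Variables (x : 'I_s -> Q) (p : 'I_s -> Q -> Q).
Hypotheses (oreB : iterated_ore_extension B x) (pP : formal_partials B x p).

Let der i : derivation (p i). Proof. by case: (pP i). Qed.
Let pB i b : B b -> p i b = 0. Proof. by case: (pP i) => _ + _; apply. Qed.
Let px i k : p i (x k) = (i == k)%:R. Proof. by case: (pP i). Qed.

Let der_nat i (b : bool) : p i b%:R = 0.
Proof. by case: b; rewrite ?(der1 (der i)) ?(der0 (der i)). Qed.

Lemma formal_partials_comm i k q : p i (p k q) = p k (p i q).
Proof.
have D := derD (der _); have M := derM (der _).
apply: (iterated_ore_generated (P := [set q | p i (p k q) = p k (p i q)]) oreB).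
- split=> [|a b /= ea eb|a b /= ea eb] /=.
  + by rewrite !(der1 (der _)) !(der0 (der _)).
  + by rewrite !(derB (der _)) ea eb.
  + by rewrite !M !D !M ea eb addrACA.
- by move=> b Bb /=; rewrite (pB k Bb) (pB i Bb) !(der0 (der _)).
- by move=> l /=; rewrite !px !der_nat.
Qed.

Lemma formal_partials_nilpotent i : locally_nilpotent (p i).
Proof.
apply: (iterated_ore_generated (P :=
  [set q | exists n, iter n (p i) q = 0]) oreB).
- split=> [|a b [m am] [n bn]|a b [m am] [n bn]].
  + by exists 1%N; rewrite /= (der1 (der i)).
  + exists (m + n)%N; rewrite (iter_derB (der i)).
    rewrite (iter_der_eq0_le (der i) (leq_addr _ _) am).
    by rewrite (iter_der_eq0_le (der i) (leq_addl _ _) bn) subrr.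
  + by exists (m + n)%N; apply: iter_derM_eq0.
- by move=> b Bb; exists 1%N; rewrite /= pB.
- by move=> k; exists 2%N; rewrite /= px der_nat.
Qed.

End FormalPartials.

Lemma LNDs_of_formal_partials (K : fieldType) (A Q : algType K) (s : nat)
    (S : set A) (j : {lrmorphism A -> Q}) (B : set Q) (x : 'I_s -> Q)
    (p : 'I_s -> Q -> Q) :
  left_ore_set S -> S `<=` regular_elements A -> left_localization S j ->
  iterated_ore_extension B x -> (forall a, S a -> B (j a)) ->
  formal_partials B x p -> (forall i a, exists a', p i (j a) = j a') ->
  exists delta : 'I_s -> A -> A,
    commuting_LNDs_with_left_localizable_kernels delta.
Proof.
move=> oreS regS locj oreB SB pP stab.
have der i : derivation (p i) by case: (pP i).
have j_inj := left_localization_inj regS locj.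
(* The restriction of [p i] to [A]. As [j] is injective, identities between the [p i] pull back to
   the chosen preimages. *)
pose delta i a := projT1 (cid (stab i a)).
have jdelta i a : j (delta i a) = p i (j a).
  by rewrite /delta; case: cid => a' /= ->.
have jiter i n a : j (iter n (delta i) a) = iter n (p i) (j a).
  by elim: n => //= n <-.
exists delta; split.
- move=> i; split=> [k a b|a b _ _]; apply: j_inj; rewrite jdelta.
    by rewrite !linearP /= (derZ_add (der i)) !jdelta.
  by rewrite rmorphM /= (derM (der i)) rmorphD !rmorphM /= !jdelta.
- move=> i a; have [n e] := formal_partials_nilpotent oreB pP i (j a).
  by exists n; apply: j_inj; rewrite jiter e rmorph0.
- move=> i k a; apply: j_inj; rewrite !jdelta.
  exact: formal_partials_comm oreB pP i k (j a).
- have dS i a : S a -> delta i a = 0.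
    move=> Sa; apply: j_inj; rewrite jdelta rmorph0.
    by case: (pP i) => _ + _; apply; apply: SB.
  exists S; split=> // [a Sa|i].
    by split; [move=> i; apply: dS | apply: regS].
  have [t [a [St ta]]] := left_localization_num locj (x i).
  have pa k : p k (j a) = j t * (k == i)%:R.
    rewrite -ta (derM (der k)); case: (pP k) => _ pB ->.
    by rewrite pB ?mul0r ?add0r //; apply: SB.
  exists t; split=> //; exists a.
    move=> k /negPf ki; apply: j_inj.
    by rewrite jdelta pa ki mulr0 rmorph0.
  by apply: j_inj; rewrite jdelta pa eqxx mulr1.
Qed.

(** * Ore extensions from locally nilpotent derivations *)

Lemma natr_scale_inj (K : fieldType) (V : lmodType K) (n : nat) (v : V) :
  [pchar K] =i pred0 -> (0 < n)%N -> v *+ n = 0 -> v = 0.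
Proof.
move=> /pcharf0P K0; rewrite lt0n -K0 => n0 e.
by rewrite -[v]scale1r -(mulVf n0) -scalerA scaler_nat e scaler0.
Qed.

Lemma natr_scaleV (K : fieldType) (V : lmodType K) (n : nat) (v : V) :
  [pchar K] =i pred0 -> (0 < n)%N -> (n%:R^-1 *: v) *+ n = v.
Proof.
move=> /pcharf0P K0; rewrite lt0n -K0 => n0.
by rewrite -scaler_nat scalerA mulfV // scale1r.
Qed.

Section OreExtension.
Variables (K : fieldType) (Q : algType K) (T : set Q) (d : Q -> Q) (x : Q).
Hypotheses (K0 : [pchar K] =i pred0) (sT : subalgebra T) (der : derivation d).
Hypotheses (dT : forall t, T t -> T (d t)) (Tx : T x) (dx : d x = 1).
Hypothesis nilT : forall t, T t -> exists n, iter n d t = 0.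

Let R : set Q := T `&` [set q | d q = 0].

Let sR : subring R.
Proof.
apply: subringI; first by case: sT.
split=> [|a b /= a0 b0|a b /= a0 b0] /=; first by rewrite (der1 der).
  by rewrite (derB der) a0 b0 subrr.
by rewrite (derM der) a0 b0 mul0r mulr0 addr0.
Qed.

(** Evaluation at [x] turns these polynomials into the sums of the r_i x^i with r_i in [R]. The
    variable of [{poly Q}] is central and [x] is not, so only addition, left multiplication by [R]
    and right multiplication by [x] are read off from polynomials. *)
Let poly_over (p : {poly Q}) := forall i, R p`_i.

Let poly_overMXaddC (p : {poly Q}) c :
  poly_over (p * 'X + c%:P) <-> poly_over p /\ R c.
Proof.
split=> [h|[h Rc]].
  split=> [i|]; last by have := h 0%N; rewrite coefD coefMX coefC add0r.
  by have := h i.+1; rewrite coefD coefMX coefC addr0.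
by case=> [|i]; rewrite coefD coefMX coefC /= ?add0r ?addr0.
Qed.

Let horner_in (p : {poly Q}) : poly_over p -> T p.[x].
Proof.
case: sT => sT' _; elim/poly_ind: p => [_|p c IHp /poly_overMXaddC[pR [Tc _]]].
  by rewrite horner0; apply: subring0.
rewrite hornerMXaddC; apply: subringD => //; apply: subringM => //; exact: IHp.
Qed.

(** Coefficients are constants and stand to the left of the powers of [x], so d(p(x)x + c) =
    d(p(x))x + p(x), which is the recursion for the formal derivative. *)
Let der_horner (p : {poly Q}) : poly_over p -> d p.[x] = p^`().[x].
Proof.
elim/poly_ind: p => [_|p c IHp /poly_overMXaddC[pR [_ dc]]].
  by rewrite deriv0 !horner0 (der0 der).
rewrite hornerMXaddC derivMXaddC hornerD hornerMX (derD der) (derM der) dc dx.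
by rewrite mulr1 addr0 IHp // addrC.
Qed.

Let RZ k r : R r -> R (k *: r).
Proof.
case: sT => _ TZ [Tr dr]; split; first exact: TZ.
by rewrite /= (derZ der) dr scaler0.
Qed.

Let horner_surj t : T t -> exists2 p, poly_over p & t = p.[x].
Proof.
move=> Tt; have [n] := nilT Tt; elim: n t Tt => [|n IHn] t Tt.
  by move=> /= ->; exists 0; rewrite ?horner0 // => i; rewrite coef0;
    apply: subring0.
rewrite iterSr => /(IHn _ (dT Tt))[p pR dt].
(* The antiderivative of [p] without constant term; [t - P.[x]] is the constant of integration. *)
pose P := \poly_(i < (size p).+1)
    (if i is k.+1 then (k.+1%:R : K)^-1 *: p`_k else 0).
have PR : poly_over P.
  move=> i; rewrite coef_poly; case: ifP => _; last exact: subring0.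
  by case: i => [|i]; [exact: subring0 | exact: RZ].
have P' : P^`() = p.
  apply/polyP => i; rewrite coef_deriv coef_poly ltnS.
  case: ltnP => [_|/(nth_default 0) ->]; last by rewrite mul0rn.
  exact: natr_scaleV.
have rR : R (t - P.[x]).
  split; last by rewrite /= (derB der) der_horner // P' dt subrr.
  by case: sT => -[_ + _] _; apply=> //; apply: horner_in.
exists (P + (t - P.[x])%:P); last by rewrite hornerD hornerC addrC subrK.
by move=> i; rewrite coefD coefC; case: eqP => _;
  rewrite ?addr0 //; apply: subringD.
Qed.

(** Applying d shows that the derivative of p also vanishes at [x], so it is 0 by induction on the
    size. In characteristic zero p is then constant, and equal to its value. *)
Let horner_eq0 (p : {poly Q}) : poly_over p -> p.[x] = 0 -> p = 0.
Proof.
have [n] := ubnP (size p); elim: n => // n IHn in p *;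
  rewrite ltnS => le_pn pR e.
have [sp|sp] := leqP (size p) 1.
  by move: e; rewrite (size1_polyC sp) hornerC => ->.
have p'0 : p^`() = 0.
  apply: IHn; last by rewrite -der_horner // e (der0 der).
    by apply: leq_trans le_pn; apply: lt_size_deriv;
      apply: contraTneq sp => ->; rewrite size_poly0.
  by move=> i; rewrite coef_deriv -(scaler_nat (R := K)); apply: RZ.
apply/polyP => -[|i].
  move: e; rewrite horner_coef (bigD1 (Ordinal (ltnW sp))) //= big1 ?addr0
    ?expr0 ?mulr1 ?coef0 //.
  move=> [[|i] ilt] // _ /=; have := congr1 (fun q : {poly Q} => q`_i) p'0.
  by rewrite coef_deriv coef0 => /(natr_scale_inj K0) -> //; rewrite mul0r.
have := congr1 (fun q : {poly Q} => q`_i) p'0.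
by rewrite coef_deriv !coef0 => /(natr_scale_inj K0) ->.
Qed.

(** Horner's scheme as an induction principle on [T]. *)
Let ind (P : Q -> Prop) : (forall r, R r -> P r) ->
  (forall t r, T t -> R r -> P t -> P (t * x + r)) -> forall t, T t -> P t.
Proof.
move=> PR Px t /horner_surj[p pR ->].
elim/poly_ind: p pR => [_|p c IHp /poly_overMXaddC[pR Rc]].
  by rewrite horner0; apply: PR; exact: subring0 sR.
by rewrite hornerMXaddC; apply: Px => //; [apply: horner_in | apply: IHp].
Qed.

(** The map sends the sum of the r_i x^i to the sum of the f(r_i) y^i, which is well defined by
    freeness. Multiplicativity is built up from right multiplication by [x] and left multiplication
    by [R], then left multiplication by [x] through the commutation rule, and finally an arbitrary
    left factor. *)
Lemma ore_extension_of_LND : ore_extension R T x (ad x).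
Proof.
have [sT' _] := sT.
have TM a b := @subringM _ _ a b sT'; have TD a b := @subringD _ _ a b sT'.
have RT r : R r -> T r by case.
have Rd r : R r -> R (ad x r).
  move=> [Tr dr]; split; first by case: sT' => _ + _; apply; apply: TM.
  by rewrite /= (derB der) !(derM der) dx dr mulr0 mul0r mulr1 mul1r addr0
    add0r subrr.
split; first by split=> // r [].
- split=> [//|a b _ _|a b _ _].
  + by rewrite /ad mulrDr mulrDl opprD addrACA.
  + by rewrite /ad mulrBl mulrBr !mulrA subrKA.
- by move=> r _; rewrite /ad addrC subrK.
move=> T' f y [f1 fD fM] fy ext.
have f0 : f 0 = 0 by apply: (addrI (f 0)); rewrite -fD ?addr0 //;
  apply: subring0.
pose ev (p : {poly Q}) := \sum_(i < size p) f p`_i * y ^+ i.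
(* Padding with zero coefficients lets polynomials of different sizes be summed over one range. *)
have evE n (p : {poly Q}) :
    (size p <= n)%N -> ev p = \sum_(i < n) f p`_i * y ^+ i.
  move=> le_pn; rewrite /ev -(subnKC le_pn) big_split_ord /= [X in _ + X]big1
    ?addr0 //.
  by move=> i _; rewrite nth_default ?leq_addr // f0 mul0r.
have [c cP] : {c : Q -> {poly Q} &
    forall t, T t -> poly_over (c t) /\ t = (c t).[x]}.
  apply: (choice (P := fun t p => T t -> poly_over p /\ t = p.[x])) => t.
  have [/horner_surj[p]|nT] := pselect (T t); last by exists 0.
  by exists p.
pose g t := ev (c t).
have gE p : poly_over p -> g p.[x] = ev p.
  move=> pR; rewrite /g; congr ev; have [cR e] := cP _ (horner_in pR).
  apply/eqP; rewrite -subr_eq0; apply/eqP/horner_eq0.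
    by move=> i; rewrite coefB; case: sR => _ + _; apply.
  by rewrite hornerD hornerN -e subrr.
have gD a b : T a -> T b -> g (a + b) = g a + g b.
  move=> /horner_surj[p pR ->] /horner_surj[q qR ->].
  rewrite -hornerD !gE //; last by move=> i; rewrite coefD; apply: subringD.
  set n := maxn (size p) (size q).
  rewrite (evE n p) ?leq_maxl // (evE n q) ?leq_maxr // (evE n) ?size_polyD //.
  by rewrite -big_split; apply: eq_bigr => i _; rewrite coefD fD // mulrDl.
have gR r : R r -> g r = f r.
  move=> Rr; rewrite -[in LHS](hornerC r x) gE.
    by rewrite (evE 1%N) ?size_polyC_leq1 // big_ord1 coefC expr0 mulr1.
  by move=> i; rewrite coefC; case: eqP => // _; apply: subring0.
have gx t : T t -> g (t * x) = g t * y.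
  move=> /horner_surj[p pR ->]; rewrite -hornerMX !gE //; last first.
    by move=> i; rewrite coefMX; case: eqP => // _; apply: subring0.
  rewrite (evE (size p).+1);
    last by rewrite (leq_trans (size_polyMleq _ _)) // size_polyX addn2.
  rewrite big_ord_recl coefMX /= f0 mul0r add0r /ev mulr_suml.
  by apply: eq_bigr => i _; rewrite coefMX /= exprSr mulrA.
have gRM r t : R r -> T t -> g (r * t) = f r * g t.
  move=> Rr /horner_surj[p pR ->]; rewrite -hornerCM !gE //; last first.
    by move=> i; rewrite coefCM; apply: subringM.
  rewrite (evE (size p)); last first.
    by rewrite mul_polyC; apply: size_scale_leq.
  rewrite mulr_sumr; apply: eq_bigr => i _.
  by rewrite coefCM fM // mulrA.
have gxr r : R r -> g (x * r) = y * f r.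
  move=> Rr; have -> : x * r = r * x + ad x r by rewrite /ad addrC subrK.
  have Rad := Rd _ Rr; rewrite gD ?gx ?gR ?fy //; auto.
have gtxr t r : T t -> R r -> g (t * x + r) = g t * y + f r.
  by move=> Tt Rr; rewrite gD ?(gx t) ?(gR r) //; auto.
(* Uses x(tx + r) = (xt)x + xr. *)
have gxl t : T t -> g (x * t) = y * g t.
  elim/ind => [r Rr|{}t r Tt Rr IHt]; first by rewrite gxr // gR.
  have Txt := TM _ _ Tx Tt; have Txr := TM _ _ Tx (RT _ Rr).
  rewrite mulrDr mulrA gD ?(gx (x * t)) ?(gxr r) ?IHt ?gtxr //; auto.
  by rewrite mulrDr mulrA.
(* Uses (ax + r)b = a(xb) + rb; the induction hypothesis is applied to xb, so b stays general. *)
have gM a b : T a -> T b -> g (a * b) = g a * g b.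
  move=> Ta; elim/ind: a / Ta b => [r Rr|a r Ta Rr IHa] b Tb.
    by rewrite gRM // (gR r).
  have Txb := TM _ _ Tx Tb.
  rewrite mulrDl -mulrA gD ?IHa ?(gxl b) ?(gRM r b) ?gtxr //; auto.
  by rewrite mulrDl mulrA.
exists g.
  split=> //; last by rewrite -[x]mul1r gx ?gR ?f1 ?mul1r //; case: sR; auto.
  by split=> //; rewrite gR ?f1 //; case: sR.
move=> g' [[_ g'D g'M] g'R g'x] t Tt.
elim/ind: t / Tt => [r Rr|t r Tt Rr IHt]; first by rewrite g'R // gR.
by rewrite gtxr // g'D ?(g'M t x) ?(g'R r) ?IHt ?g'x //; auto.
Qed.

End OreExtension.

(** * Monomials in several variables *)

Section MultiIndex.
Variable s : nat.
Implicit Types (alpha beta : multi_index s) (l : seq 'I_s).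

Definition mi0 : multi_index s := [ffun=> 0%N].

(** A cube of exponents, listed as the image of a finite type; it contains every multi-index of
    degree at most [n], and higher ones are filtered out where needed. *)
Definition mi_box n : seq (multi_index s) :=
  [seq [ffun i => val (f i)] | f : {ffun 'I_s -> 'I_n.+1}].

Lemma mi_box_uniq n : uniq (mi_box n).
Proof.
rewrite map_inj_uniq ?enum_uniq // => f g /ffunP e.
by apply/ffunP => i; apply: val_inj; have := e i; rewrite !ffunE.
Qed.

Lemma mem_mi_box n alpha : (mi_deg alpha <= n)%N -> alpha \in mi_box n.
Proof.
move=> le_n; apply/mapP; exists [ffun i => inord (alpha i)].
  by rewrite mem_enum.
apply/ffunP => i; rewrite !ffunE /= inordK // ltnS.
by apply: leq_trans le_n; rewrite /mi_deg (bigD1 i) //= leq_addr.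
Qed.

(** Otherwise beta <= alpha entrywise, and the inequality of degrees forces equality. It yields an
    index at which delta^beta differentiates the alpha-term too often. *)
Lemma mi_deg_lt_exists alpha beta :
  (mi_deg alpha <= mi_deg beta)%N -> alpha != beta ->
  exists i, (alpha i < beta i)%N.
Proof.
move=> le_ab ne; apply/existsP; apply: contraNT ne.
rewrite negb_exists => /forallP h.
have h' i : (beta i <= alpha i)%N by rewrite leqNgt h.
have [_] := leqif_sum (fun i (_ : xpredT i) => leqif_eq (h' i)).
rewrite eqn_leq leq_sum //= -/(mi_deg alpha) -/(mi_deg beta) le_ab =>
  /esym/forallP e.
by apply/eqP/ffunP => i; apply/esym/eqP/e.
Qed.

Variables (K : fieldType) (Q : algType K) (delta : 'I_s -> Q -> Q).
Hypotheses (K0 : [pchar K] =i pred0) (der : forall i, derivation (delta i)).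
Hypothesis comm : forall i k a, delta i (delta k a) = delta k (delta i a).

(** An arbitrary list of indices replaces [enum 'I_s] to permit induction on it. *)
Let dpow l alpha a := foldr (fun i => iter (alpha i) (delta i)) a l.

Let C := common_kernel delta.

Lemma iter_delta_comm i k n a :
  delta i (iter n (delta k) a) = iter n (delta k) (delta i a).
Proof. by elim: n => //= n IHn; rewrite comm IHn. Qed.

Let dpow_comm i l alpha a : delta i (dpow l alpha a) = dpow l alpha (delta i a).
Proof. by elim: l => //= k l IHl; rewrite iter_delta_comm IHl. Qed.

Let dpow_iter_comm i n l alpha a :
  iter n (delta i) (dpow l alpha a) = dpow l alpha (iter n (delta i) a).
Proof. by elim: n => //= n ->; rewrite dpow_comm. Qed.

Let dpowD l alpha a b : dpow l alpha (a + b) = dpow l alpha a + dpow l alpha b.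
Proof. by elim: l => //= i l ->; rewrite (iter_derD (der i)). Qed.

Let dpow0 l alpha : dpow l alpha 0 = 0.
Proof. by elim: l => //= i l ->; rewrite (iter_der0 (der i)). Qed.

Lemma delta_pow_mi0 a : delta_pow delta mi0 a = a.
Proof. by rewrite /delta_pow; elim: (enum _) => //= i l ->; rewrite ffunE. Qed.

Lemma delta_powD alpha a b :
  delta_pow delta alpha (a + b) =
  delta_pow delta alpha a + delta_pow delta alpha b.
Proof. exact: dpowD. Qed.

Lemma delta_pow0 alpha : delta_pow delta alpha 0 = 0.
Proof. exact: dpow0. Qed.

Lemma delta_pow_sum alpha I (r : seq I) (P : pred I) (F : I -> Q) :
  delta_pow delta alpha (\sum_(i <- r | P i) F i) =
  \sum_(i <- r | P i) delta_pow delta alpha (F i).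
Proof. exact: (big_morph _ (delta_powD alpha) (delta_pow0 alpha)). Qed.

Lemma delta_powN alpha a :
  delta_pow delta alpha (- a) = - delta_pow delta alpha a.
Proof. by apply/eqP; rewrite -addr_eq0 -delta_powD addNr delta_pow0. Qed.

Lemma delta_pow_eq0 alpha i n a :
  (n <= alpha i)%N -> iter n (delta i) a = 0 -> delta_pow delta alpha a = 0.
Proof.
move=> le_n an; have : i \in enum 'I_s by rewrite mem_enum.
rewrite /delta_pow; elim: (enum _) => //= k l IHl; rewrite inE.
have [<- _|_ /= /IHl ->] := eqVneq; last exact: iter_der0.
rewrite -/(dpow l alpha a) dpow_iter_comm.
by rewrite (iter_der_eq0_le (der i) le_n an) dpow0.
Qed.

(** Pigeonhole: if |alpha| exceeds the sum of the nilpotency indices of [a], some entry of alpha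
    exceeds its own index. *)
Lemma nil_filtration_exhausts :
  (forall i, locally_nilpotent (delta i)) ->
  \bigcup_n nil_filtration delta n = setT.
Proof.
move=> nil; apply/seteqP; split=> // a _.
have [n nP] : {n : 'I_s -> nat & forall i, iter (n i) (delta i) a = 0}.
  exact: (choice (P := fun i n => iter n (delta i) a = 0) (fun i => nil i a)).
exists (\sum_(i < s) n i)%N => // alpha lt_n.
have [i lt_i] : exists i, (n i < alpha i)%N.
  apply/existsP; apply: contraTT lt_n; rewrite negb_exists => /forallP h.
  by rewrite -leqNgt; apply: leq_sum => i _; rewrite leqNgt h.
exact: delta_pow_eq0 (ltnW lt_i) (nP i).
Qed.

Definition mi_incr i alpha : multi_index s :=
  [ffun k => (alpha k + (k == i))%N].
(** Truncation at [alpha i = 0] is harmless, because the derivative then carries the factor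
    [alpha i]. *)
Definition mi_decr i alpha : multi_index s :=
  [ffun k => (alpha k - (k == i))%N].

Lemma mi_deg_incr i alpha : mi_deg (mi_incr i alpha) = (mi_deg alpha).+1.
Proof.
rewrite /mi_deg (eq_bigr (fun k => alpha k + (k == i))%N); last first.
  by move=> k _; rewrite ffunE.
rewrite big_split /= -addn1; congr (_ + _)%N.
by rewrite (bigD1 i) //= eqxx big1 // => k /negPf ->.
Qed.

Lemma delta_pow_incr i alpha a :
  delta_pow delta (mi_incr i alpha) a = delta i (delta_pow delta alpha a).
Proof.
have : i \in enum 'I_s by rewrite mem_enum.
have : uniq (enum 'I_s) by rewrite enum_uniq.
rewrite /delta_pow; elim: (enum _) => //= k l IHl /andP[kl ul].
rewrite inE ffunE -/(dpow l alpha a) -/(dpow l (mi_incr i alpha) a).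
have [-> _|ne /= il] := eqVneq i k; last first.
  by rewrite addn0 iter_delta_comm -IHl.
rewrite addn1 /=; congr (delta k (iter _ _ _)).
(* The index [k] does not occur in the rest of the list, which therefore ignores the increment. *)
elim: l kl {IHl ul} => //= m l IHl; rewrite inE negb_or => /andP[km kl].
by rewrite IHl // ffunE eq_sym (negPf km) addn0.
Qed.

(** Makes the statements about constants the case n = 0 of those about the filtration. *)
Lemma common_kernel_nil_filtration :
  common_kernel delta = nil_filtration delta 0.
Proof.
apply/seteqP; split=> [a aC alpha gt0|a aN i].
  have deg0 : mi_deg mi0 = 0%N by apply: big1 => i _; rewrite ffunE.
  have [||i lt_i] := @mi_deg_lt_exists mi0 alpha; first by rewrite deg0.
    by apply: contraTneq gt0 => <-; rewrite deg0.
  by apply: (delta_pow_eq0 (i := i) (n := 1));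
    [apply: leq_ltn_trans lt_i | apply: aC].
by rewrite -[a]delta_pow_mi0 -delta_pow_incr aN // mi_deg_incr.
Qed.

(* [term alpha c] stands for either of c x^alpha and x^alpha c. *)
Variable term : multi_index s -> Q -> Q.
Hypothesis term0r : forall alpha, term alpha 0 = 0.
Hypothesis term_mi0 : forall c, term mi0 c = c.
Hypothesis delta_term : forall i alpha c, C c ->
  delta i (term alpha c) = term (mi_decr i alpha) c *+ alpha i.

Let iter_term i n alpha c : C c ->
  iter n (delta i) (term alpha c) =
  term [ffun k => (alpha k - (k == i) * n)%N] c *+ (alpha i ^_ n).
Proof.
move=> Cc; elim: n => [|n IHn] /=.
  rewrite ffactn0 mulr1n; congr (term _ _).
  by apply/ffunP => k; rewrite ffunE muln0 subn0.
rewrite IHn (derMn (der i)) delta_term // -mulrnA !ffunE eqxx mul1n mulnC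
  ffactnSr.
congr (term _ _ *+ _); apply/ffunP => k; rewrite !ffunE mulnS.
by rewrite addnC subnDA.
Qed.

(** The falling factorials vanish as soon as some beta_i > alpha_i with i in [l], and they multiply
    to alpha! when beta = alpha and [l] lists all indices. *)
Let dpow_term l beta alpha c : uniq l -> C c ->
  dpow l beta (term alpha c) =
  term [ffun k => (alpha k - (k \in l) * beta k)%N] c
    *+ (\prod_(i <- l) (alpha i ^_ beta i))%N.
Proof.
move=> + Cc; elim: l => [_|i l IHl /= /andP[il ul]].
  rewrite big_nil mulr1n /=; congr (term _ _).
  by apply/ffunP => k; rewrite ffunE subn0.
rewrite IHl //.
have iterMn n a m : iter n (delta i) (a *+ m) = iter n (delta i) a *+ m.
  by elim: n => //= n ->; rewrite (derMn (der i)).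
rewrite iterMn iter_term // -mulrnA big_cons ffunE (negPf il) mul0n subn0.
congr (term _ _ *+ _); apply/ffunP => k; rewrite !ffunE inE -subnDA.
have [->|_] := eqVneq k i; first by rewrite (negPf il) mul0n.
by rewrite mul0n addn0.
Qed.

Let dfact alpha : nat := (\prod_(i <- enum 'I_s) (alpha i)`!)%N.

Let dfact_gt0 alpha : (0 < dfact alpha)%N.
Proof. by apply: prodn_gt0 => i; apply: fact_gt0. Qed.

Let delta_pow_term_diag alpha c : C c ->
  delta_pow delta alpha (term alpha c) = c *+ dfact alpha.
Proof.
move=> Cc; rewrite [LHS]dpow_term ?enum_uniq //.
rewrite (eq_bigr (fun i => (alpha i)`!)); last by move=> i _; rewrite ffactnn.
congr (_ *+ _); rewrite -[RHS]term_mi0; congr (term _ _).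
by apply/ffunP => k; rewrite !ffunE mem_enum mul1n subnn.
Qed.

Let delta_pow_term_eq0 alpha beta c : C c ->
  (mi_deg alpha <= mi_deg beta)%N -> alpha != beta ->
  delta_pow delta beta (term alpha c) = 0.
Proof.
move=> Cc le_ab ne; have [i lt_i] := mi_deg_lt_exists le_ab ne.
rewrite [LHS]dpow_term ?enum_uniq //.
by rewrite (bigD1_seq i) ?enum_uniq ?mem_enum //= ffact_small //.
Qed.

(** Descending induction on |alpha|, with [M] bounding all degrees: delta^alpha kills every other
    term of degree at most |alpha|, the higher coefficients are already 0, and alpha! b(alpha) = 0
    remains. *)
Lemma term_independent (E : seq (multi_index s)) (b : multi_index s -> Q) :
  uniq E -> {in E, forall alpha, C (b alpha)} ->
  \sum_(alpha <- E) term alpha (b alpha) = 0 ->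
  {in E, forall alpha, b alpha = 0}.
Proof.
move=> uE bC sum0 alpha.
pose M := (\sum_(alpha <- E) mi_deg alpha)%N.
have degM beta : beta \in E -> (mi_deg beta <= M)%N.
  by move=> bE; rewrite /M (bigD1_seq beta) //= leq_addr.
have [m] := ubnP (M - mi_deg alpha); elim: m => // m IHm in alpha *.
rewrite ltnS => le_m aE.
have := delta_pow_sum alpha E xpredT (fun alpha => term alpha (b alpha)).
rewrite sum0 delta_pow0 (bigD1_seq alpha) //= (delta_pow_term_diag _ (bC _ aE)).
rewrite big_seq_cond big1 ?addr0; last first.
  move=> beta /andP[bE ne].
  have [lt_ab|le_ba] := ltnP (mi_deg alpha) (mi_deg beta); last first.
    by apply: delta_pow_term_eq0 => //; apply: bC.
  rewrite (IHm beta) ?term0r ?delta_pow0 //.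
  apply: leq_trans le_m; apply: ltn_sub2l => //.
  exact: leq_trans lt_ab (degM _ bE).
by move/esym/(natr_scale_inj K0); apply.
Qed.

Lemma term_spanning (L : seq (multi_index s)) n q :
  uniq L -> (forall alpha, (mi_deg alpha < n)%N -> alpha \in L) ->
  (forall alpha, (n <= mi_deg alpha)%N -> delta_pow delta alpha q = 0) ->
  exists b : multi_index s -> Q, (forall alpha, C (b alpha)) /\
    q = \sum_(alpha <- L | (mi_deg alpha < n)%N) term alpha (b alpha).
Proof.
move=> uL; elim: n q => [|n IHn] q LP qn.
  exists (fun=> 0); split; first by move=> alpha i; rewrite (der0 (der i)).
  by rewrite big_pred0_eq -(qn mi0) // delta_pow_mi0.
(* Taylor coefficients of top degree; they are constants because all delta^beta(q) with |beta| = n +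
   1 vanish. *)
pose b1 alpha := if mi_deg alpha == n then
  (dfact alpha)%:R^-1 *: delta_pow delta alpha q else 0.
have b1C alpha : C (b1 alpha).
  rewrite /b1; case: eqP => [dn i|_ i]; last by rewrite (der0 (der i)).
  by rewrite (derZ (der i)) -delta_pow_incr qn ?scaler0 // mi_deg_incr dn.
pose q1 := \sum_(alpha <- L | mi_deg alpha == n) term alpha (b1 alpha).
have [|beta le_nb|b0 [b0C q0]] := IHn (q - q1).
- by move=> alpha lt_n; apply: LP; apply: ltnW.
- rewrite delta_powD delta_powN delta_pow_sum.
  (* For |beta| > n both [q] and [q1] are killed. For |beta| = n only the beta-term of [q1]
     survives, and it cancels delta^beta(q). *)
  have [eq_bn|ne_bn] := eqVneq (mi_deg beta) n; last first.
    rewrite qn ?sub0r; last by rewrite ltn_neqAle eq_sym ne_bn.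
    rewrite big1 ?oppr0 // => alpha /eqP da.
    apply: delta_pow_term_eq0 => //; first by rewrite da.
    by apply: contraNneq ne_bn => <-; rewrite da.
  rewrite (big_rem beta) /=; last by apply: LP; rewrite eq_bn.
  have b1E : b1 beta *+ dfact beta = delta_pow delta beta q.
    by rewrite /b1 eq_bn eqxx natr_scaleV.
  rewrite eq_bn eqxx delta_pow_term_diag // b1E.
  rewrite big_seq_cond big1 ?addr0 ?subrr // => alpha /andP[aL /eqP da].
  apply: delta_pow_term_eq0 => //; first by rewrite da eq_bn.
  by move: aL; rewrite mem_rem_uniq // inE => /andP[].
exists (fun alpha => if mi_deg alpha == n then b1 alpha else b0 alpha).
split; first by move=> alpha; case: ifP.
rewrite (bigID (fun alpha => mi_deg alpha == n)) /=.
rewrite -[LHS](subrK q1) [RHS]addrC; congr (_ + _).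
  rewrite q0; apply: eq_big => [alpha|alpha];
    first by rewrite ltnS ltn_neqAle andbC.
  by rewrite ltn_neqAle => /andP[/negPf ->].
apply: eq_big => [alpha|alpha /eqP ->]; last by rewrite eqxx.
by rewrite ltnS; case: eqP => [->|]; rewrite ?leqnn ?andbF.
Qed.

Lemma nil_filtration_free_sum n :
  free_direct_sum C term (fun alpha => (mi_deg alpha <= n)%N)
    (nil_filtration delta n).
Proof.
split=> [q|E b uE bC]; last by apply: term_independent => // alpha /bC[].
split=> [qn|[E [b [uE bP ->]]] alpha lt_n].
  have [b [bC ->]] := term_spanning (mi_box_uniq n)
    (fun alpha (h : (mi_deg alpha < n.+1)%N) => mem_mi_box h) qn.
  exists [seq alpha <- mi_box n | (mi_deg alpha <= n)%N], b; split.
  - by rewrite filter_uniq // mi_box_uniq.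
  - by move=> alpha; rewrite mem_filter => /andP[].
  - by rewrite big_filter.
rewrite delta_pow_sum big_seq big1 // => beta /bP[le_n Cb].
have lt_ba := leq_ltn_trans le_n lt_n.
apply: delta_pow_term_eq0 => //; first exact: ltnW.
by apply: contraTneq lt_ba => ->; rewrite ltnn.
Qed.

End MultiIndex.

(** * Derivatives of ordered monomials *)

Section Monomials.
Variables (s : nat) (K : fieldType) (Q : algType K) (delta : 'I_s -> Q -> Q).
Variable x : 'I_s -> Q.
Hypotheses (der : forall i, derivation (delta i)).
Hypothesis delta_x : forall i k, delta i (x k) = (i == k)%:R.

Lemma monomial_mi0 : monomial x (mi0 s) = 1.
Proof. by rewrite /monomial big1 // => i _; rewrite ffunE expr0. Qed.

(** Although the x_k may fail to commute, delta_i affects only the factor x_i^alpha_i, which it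
    differentiates in place. *)
Lemma delta_monomial i (alpha : multi_index s) :
  delta i (monomial x alpha) = monomial x (mi_decr i alpha) *+ alpha i.
Proof.
rewrite /monomial.
(* Generalized for induction on the list: a product in which x_i does not occur is killed. *)
suff : uniq (index_enum 'I_s) ->
  delta i (\prod_(k <- index_enum 'I_s) x k ^+ alpha k) =
  if i \in index_enum 'I_s then
    (\prod_(k <- index_enum 'I_s) x k ^+ mi_decr i alpha k) *+ alpha i else 0.
  by rewrite mem_index_enum index_enum_uniq; apply.
elim: (index_enum _) => [_|k l IHl /= /andP[kl ul]].
  by rewrite big_nil (der1 (der i)).
rewrite !big_cons (derM (der i)) IHl // inE ffunE.
have same : i \notin l -> \prod_(m <- l) x m ^+ mi_decr i alpha m =
    \prod_(m <- l) x m ^+ alpha m.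
  move=> il; apply: eq_big_seq => m ml; rewrite ffunE.
  by case: eqP => [e|_]; [rewrite -e ml in il | rewrite subn0].
have [e|ne] := eqVneq i k.
  rewrite -e in kl *; rewrite (negPf kl) mulr0 addr0 same // subn1.
  by rewrite der_exp ?delta_x ?eqxx // mulrnAl.
rewrite /= subn0.
have -> : delta i (x k ^+ alpha k) = 0.
  elim: (alpha k) => [|n IHn]; first by rewrite expr0 (der1 (der i)).
  by rewrite exprS (derM (der i)) IHn delta_x (negPf ne) mul0r mulr0 addr0.
by rewrite mul0r add0r; case: ifP; rewrite ?mulr0 // mulrnAr.
Qed.

End Monomials.

(** * Commuting derivations with slices *)

Section Slices.
Variables (K : fieldType) (Q : algType K) (s : nat).
Variables (delta : 'I_s -> Q -> Q) (x : 'I_s -> Q).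
Hypotheses (K0 : [pchar K] =i pred0) (der : forall i, derivation (delta i)).
Hypothesis nil : forall i, locally_nilpotent (delta i).
Hypothesis comm : forall i k a, delta i (delta k a) = delta k (delta i a).
Hypothesis delta_x : forall i k, delta i (x k) = (i == k)%:R.

Let C := common_kernel delta.

Lemma slices_iterated_ore_extension : iterated_ore_extension C x.
Proof.
(* Indices start at 0, so [R n] contains x_0, ..., x_{n-1}, and passing to [R n.+1] drops the
   condition of being killed by delta_n. *)
pose R n : set Q := [set q | forall k : 'I_s, (n <= k)%N -> delta k q = 0].
exists R; split; first by apply/seteqP; split=> q qC k => [|_]; apply: qC.
  by apply/seteqP; split=> // q _ k; rewrite leqNgt ltn_ord.
move=> i; have -> : R i = R i.+1 `&` [set q | delta i q = 0].
  apply/seteqP; split=> [q Rq|q [Rq qi] k].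
    by split=> [k /ltnW|]; apply: Rq.
  by rewrite leq_eqVlt => /predU1P[/val_inj <-|/Rq].
apply: ore_extension_of_LND => //.
- split; first exact: (subring_kernel der [pred k : 'I_s | (i < k)%N]).
  by move=> a q Rq k lt_ik; rewrite (derZ (der k)) Rq ?scaler0.
- by move=> q Rq k lt_ik; rewrite comm Rq // (der0 (der i)).
- by move=> k lt_ik; rewrite delta_x -val_eqE /= gtn_eqF.
- by rewrite delta_x eqxx.
- by move=> q _; apply: nil.
Qed.

Lemma slices_ad_stable : ad_stable C x.
Proof.
(* Both delta_k(x_i) and delta_k(q) are integers, hence central, so delta_k kills [x_i, q].
   Constants are the case n = 0, and variables have n = 0 or 1. *)
have dad k i q (n : nat) : delta k q = n%:R -> delta k (ad (x i) q) = 0.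
  move=> dq; rewrite /ad (derB (der k)) !(derM (der k)) delta_x dq.
  by rewrite !mulr_natl !mulr_natr [X in _ - X]addrC subrr.
split=> [i b bC k|i l k]; first by apply: (dad _ _ _ 0%N); apply: bC.
exact: dad (delta_x k l).
Qed.

Lemma slices_filtration_sums n :
  left_monomial_sum C x (fun alpha => (mi_deg alpha <= n)%N)
    (nil_filtration delta n) /\
  right_monomial_sum C x (fun alpha => (mi_deg alpha <= n)%N)
    (nil_filtration delta n).
Proof.
split; apply: nil_filtration_free_sum => //.
- by move=> alpha; rewrite mul0r.
- by move=> c; rewrite monomial_mi0 // mulr1.
- by move=> i alpha c cC;
  rewrite (derM (der i)) cC mul0r add0r delta_monomial // mulrnAr.
- by move=> alpha; rewrite mulr0.
- by move=> c; rewrite monomial_mi0 // mul1r.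
- by move=> i alpha c cC;
  rewrite (derM (der i)) cC mulr0 addr0 delta_monomial // mulrnAl.
Qed.

(** An element lies in some step of the filtration, and a finite relation has degrees bounded by
    their sum. *)
Lemma free_direct_sum_exhausted term :
  (forall n, free_direct_sum C term
    (fun alpha : multi_index s => (mi_deg alpha <= n)%N)
    (nil_filtration delta n)) ->
  free_direct_sum C term xpredT setT.
Proof.
move=> sums; split=> [q|E b uE bC].
  split=> // _; have [n _ qn] : (\bigcup_n nil_filtration delta n) q.
    by rewrite nil_filtration_exhausts.
  have [/(_ q)[/(_ qn)[E [b [uE bP ->]]] _] _] := sums n.
  by exists E, b; split=> // alpha /bP[].
have [_] := sums (\sum_(alpha <- E) mi_deg alpha)%N; apply=> // alpha aE.
by split; [rewrite (bigD1_seq alpha) //= leq_addr | case: (bC _ aE)].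
Qed.

End Slices.

(** The common source of the forward implication and of the explicit description of the
    localization. *)
Lemma slices_exist (K : fieldType) (A : algType K) (s : nat)
    (delta : 'I_s -> A -> A) :
  commuting_LNDs_with_left_localizable_kernels delta ->
  exists S : set A,
    [/\ left_ore_set S,
        S `<=` common_kernel delta `&` regular_elements A
      & exists (Q : algType K) (j : {lrmorphism A -> Q})
               (delta' : 'I_s -> Q -> Q) (x : 'I_s -> Q),
          [/\ left_localization S j,
              forall i, derivation (delta' i) /\
                        forall a, delta' i (j a) = j (delta i a),
              forall i, locally_nilpotent (delta' i),
              forall i k a, delta' i (delta' k a) = delta' k (delta' i a)
            & forall i k, delta' i (x k) = (i == k)%:R]].
Proof.
move=> [der nil comm [S [oreS SP slice]]]; exists S; split=> //.
have regS : S `<=` regular_elements A by move=> a /SP[].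
have dS i a : S a -> delta i a = 0 by move=> /SP[/(_ i)].
have [Q [j locj]] := left_localization_exists oreS regS.
have ext i := derivation_extends oreS regS locj (der i) (@dS i).
pose delta' i := projT1 (cid (ext i)).
have [der' j' ] : (forall i, derivation (delta' i)) /\
    (forall i a, delta' i (j a) = j (delta i a)).
  by split=> i; rewrite /delta'; case: cid => d' [].
(* Denominators are constants, so iterates act on numerators; nilpotency and commutation thus
   descend to [A]. *)
have num i s0 a q n : S s0 -> j s0 * q = j a ->
    j s0 * iter n (delta' i) q = j (iter n (delta i) a).
  move=> Ss0 e; elim: n => //= n IHn.
  by rewrite -j' -IHn (derM (der' i)) j' dS // rmorph0 mul0r add0r.
have num1 i s0 a q : S s0 -> j s0 * q = j a ->
    j s0 * delta' i q = j (delta i a) by apply: (num i s0 a q 1%N).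
have xP k : exists q, forall i, delta' i q = (i == k)%:R.
  have [t [St [y yk yt]]] := slice k.
  have [u [_ tu]] : exists u, inverse_of (j t) u by case: locj => + _ _; apply.
  exists (u * j y) => i; apply: (left_localization_cancel locj St).
  rewrite (num1 i t y) //; last by rewrite mulrA tu mul1r.
  have [->|/yk ->] := eqVneq i k; first by rewrite yt mulr1.
  by rewrite rmorph0 mulr0.
exists Q, j, delta', (fun k => projT1 (cid (xP k))); split=> //.
- move=> i q; have [t [a [St tq]]] := left_localization_num locj q.
  have [n an] := nil i a; exists n.
  apply: (left_localization_cancel locj St).
  by rewrite (num i t a q n St tq) an rmorph0 mulr0.
- move=> i k q; have [t [a [St tq]]] := left_localization_num locj q.
  apply: (left_localization_cancel locj St).
  rewrite (num1 i t (delta k a) (delta' k q) St (num1 k t a q St tq)).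
  by rewrite (num1 k t (delta i a) (delta' i q) St (num1 i t a q St tq)) comm.
- by move=> i k; case: cid => q /=.
Qed.

Theorem theorem5p1 (K : fieldType) (hK : [pchar K] =i pred0) (A : algType K)
    (s : nat) (hs : (0 < s)%N) :
  ((exists delta : 'I_s -> A -> A,
      commuting_LNDs_with_left_localizable_kernels delta)
   <->
   (exists S : set A,
      [/\ left_ore_set S,
          S `<=` regular_elements A
        & exists (Q : algType K) (j : {lrmorphism A -> Q}) (B : set Q)
                 (x : 'I_s -> Q) (p : 'I_s -> Q -> Q),
            [/\ left_localization S j,
                subalgebra B /\ iterated_ore_extension B x,
                (forall a, S a -> B (j a)) /\ ad_stable B x,
                formal_partials B x p
              & forall i a, exists a', p i (j a) = j a']]))
  /\
  (forall delta : 'I_s -> A -> A,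
     commuting_LNDs_with_left_localizable_kernels delta ->
     exists S : set A,
       [/\ left_ore_set S,
           S `<=` common_kernel delta `&` regular_elements A
         & exists (Q : algType K) (j : {lrmorphism A -> Q})
                  (delta' : 'I_s -> Q -> Q) (x : 'I_s -> Q),
             let C := common_kernel delta' in
             let N := nil_filtration delta in
             let N' := nil_filtration delta' in
             [/\ left_localization S j,
                 forall i, derivation (delta' i) /\
                           forall a, delta' i (j a) = j (delta i a),
                 iterated_ore_extension C x /\ ad_stable C x,
                 [/\ left_monomial_sum C x xpredT setT,
                     right_monomial_sum C x xpredT setT,
                     \bigcup_n N' n = setT
                   & forall n,
                       left_monomial_sum C x
                         (fun alpha => (mi_deg alpha <= n)%N) (N' n) /\
                       right_monomial_sum C x
                         (fun alpha => (mi_deg alpha <= n)%N) (N' n)]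
               & [/\ \bigcup_n N n = setT,
                     forall n, N' n = fractions j S (N n),
                     fractions j S (common_kernel delta) = C
                   & j @` common_kernel delta = range j `&` C]]]).
Proof.
split.
  split=> [[delta /slices_exist]|]; last first.
    move=> [S [oreS regS [Q [j [B [x [p [locj [_ oreB] [SB _] pP stab]]]]]]]].
    exact: LNDs_of_formal_partials oreS regS locj oreB SB pP stab.
  move=> [S [oreS SP [Q [j [delta' [x [locj ext nil comm dx]]]]]]].
  have der i : derivation (delta' i) by case: (ext i).
  exists S; split=> //; first by move=> a /SP[].
  exists Q, j, (common_kernel delta'), x, delta'; split=> //.
  - split; first exact: subalgebra_common_kernel.
    exact: slices_iterated_ore_extension.
  - split; last exact: slices_ad_stable.
    by move=> a /SP[aC _] i; case: (ext i) => _ ->; rewrite aC rmorph0.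
  - by move=> i a; exists (delta i a); case: (ext i).
move=> delta lnd; have [deltader deltanil deltacomm _] := lnd.
have [S [oreS SP [Q [j [delta' [x [locj ext nil comm dx]]]]]]] :=
  slices_exist lnd.
have der i : derivation (delta' i) by case: (ext i).
have regS : S `<=` regular_elements A by move=> a /SP[].
have j_inj := left_localization_inj regS locj.
have jpow alpha a : delta_pow delta' alpha (j a) = j (delta_pow delta alpha a).
  rewrite /delta_pow; elim: (enum _) => //= i l ->.
  by elim: (alpha i) => //= n ->; case: (ext i) => _ ->.
have SC t : S t -> common_kernel delta' (j t).
  by move=> /SP[tC _] i; case: (ext i) => _ ->; rewrite tC rmorph0.
have jpowM alpha c q : common_kernel delta' c ->
    delta_pow delta' alpha (c * q) = c * delta_pow delta' alpha q.
  move=> cC; rewrite /delta_pow; elim: (enum _) => //= i l ->.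
  by elim: (alpha i) => //= n ->; rewrite (derM (der i)) cC mul0r add0r.
(* A denominator and its inverse are both constants, so they pass through delta^alpha, and q lies in
   the filtration exactly when its numerator does. *)
have NE n : nil_filtration delta' n = fractions j S (nil_filtration delta n).
  apply/seteqP; split=> [q qn|q [t [a [u [St an [ut tu] ->]]]] alpha lt_n].
    have [t [a [St tq]]] := left_localization_num locj q.
    have [u [ut tu]] : exists u, inverse_of (j t) u.
      by case: locj => + _ _; apply.
    exists t, a, u; split=> //; last by rewrite -tq mulrA ut mul1r.
    move=> alpha lt_n; apply: j_inj.
    by rewrite -jpow -tq jpowM ?qn ?mulr0 ?rmorph0 //; apply: SC.
  rewrite jpowM ?jpow ?an ?rmorph0 ?mulr0 // => i.
  exact: (der_inverse (der i) (conj ut tu) (SC _ St i)).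
exists S; split=> //; exists Q, j, delta', x => C N N'.
have [lsums rsums] :
    (forall n,
      left_monomial_sum C x (fun alpha => (mi_deg alpha <= n)%N) (N' n)) /\
    (forall n,
      right_monomial_sum C x (fun alpha => (mi_deg alpha <= n)%N) (N' n)).
  by split=> n; case: (slices_filtration_sums hK der comm dx n).
split=> //.
- by split; [exact: slices_iterated_ore_extension | exact: slices_ad_stable].
- split=> //; last exact: nil_filtration_exhausts.
    exact: free_direct_sum_exhausted lsums.
  exact: free_direct_sum_exhausted rsums.
- split=> //; first exact: nil_filtration_exhausts.
    by rewrite /C !common_kernel_nil_filtration // NE.
  apply/seteqP; split=> [_ [a aC <-]|_ [[a _ <-] aC]].
    by split; [exists a | move=> i; case: (ext i) => _ ->; rewrite aC rmorph0].
  by exists a => // i; apply: j_inj; case: (ext i) => _ <-; rewrite aC rmorph0.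
Qed.
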